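(* Let $q\in\mathbb{N}$ with $q\geq 3$, and let $K\subset\mathbb{R}$ be the self-similar set generated by the iterated function system $$\left\{f_1(x)=\frac{x}{q},\ f_2(x)=\frac{x+q-1}{q}\right\},$$ i.e. the unique non-empty compact set with $K=f_1(K)\cup f_2(K)$. Let $$s=s(q)=\sum_{n=1}^{\infty}\frac{1}{q^{n!}}.$$ Then for every $\ell\in\{1,2,\dots,q-2\}$, $$K-\ell s=\{x-\ell s:x\in K\}\subset\mathbb{Q}^c,$$ i.e. every element of $K-\ell s$ is irrational. In particular, for $q=3$, $K$ is the middle-third Cantor set $C$, and $C-s(3)\subset\mathbb{Q}^c$. *)

(* Defs.v *)
From HB Require Import structures.
From mathcomp Require Export all_boot all_order all_algebra.
From mathcomp Require Export all_classical all_reals.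
From mathcomp Require Export topology normedtype sequences.

Set Implicit Arguments.
Unset Strict Implicit.
Unset Printing Implicit Defensive.

Import Order.TTheory GRing.Theory Num.Theory.
Import numFieldNormedType.Exports.

Local Open Scope classical_set_scope.
Local Open Scope ring_scope.

Section Definitions.
Variable R : realType.

Definition ifs1 (q : nat) (x : R) : R := x / q%:R.

Definition ifs2 (q : nat) (x : R) : R := (x + q%:R - 1) / q%:R.

(* Hutchinson's theorem: for contractions f1 and f2 exactly one set K has
   this property. *)
Definition self_similar_set (f1 f2 : R -> R) (K : set R) : Prop :=
  [/\ K !=set0, compact K & K = (f1 @` K) `|` (f2 @` K)].

Definition factorial_series (q : nat) : R :=
  limn (fun N : nat => (\sum_(1 <= n < N.+1) 1 / q%:R ^+ n`! : R)).

(* A pair (a, b) stands for the closed interval [a, b]. *)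
Definition remove_middle_third (I : R * R) : seq (R * R) :=
  let: (a, b) := I in
  [:: (a, a + (b - a) / 3%:R); (b - (b - a) / 3%:R, b)].

Fixpoint cantor_intervals (n : nat) : seq (R * R) :=
  if n is m.+1 then flatten (map remove_middle_third (cantor_intervals m))
  else [:: (0, 1)].

Definition cantor_stage (n : nat) : set R :=
  [set x | exists2 I : R * R, I \in cantor_intervals n & I.1 <= x <= I.2].

Definition middle_third_cantor_set : set R := \bigcap_n cantor_stage n.

End Definitions.

Arguments factorial_series : clear implicits.
Arguments cantor_stage : clear implicits.
Arguments middle_third_cantor_set : clear implicits.

(* Main.v *)
(** Multiplying [x \in K] by a power of [q] gives, modulo 1, a point of [K], hence
    a number within [1/q] of an integer.  Suppose [x - l s = r] is rational.  The
    numbers [q^k r] are eventually periodic modulo 1, and [q^(n! - j) s] is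
    [q^-j] plus a tiny positive number modulo 1.  Letting [n] grow yields a purely
    periodic backward orbit [u_j] of multiplication by [q] such that each
    [u_j + l q^-j], and each [u_j], lies in [[-1/q, 1/q)] modulo 1.  For [j = 1]
    this forces [l = 1] and [u_1 < 0]; then the carry produced by [q^-j]
    propagates and forces [u_(j+1) = u_j / q] for all [j >= 1], which
    contradicts periodicity. *)

From mathcomp Require Import ring lra zify.
Require Import Defs.

Import Order.TTheory GRing.Theory Num.Theory.
Import numFieldNormedType.Exports.

Local Open Scope classical_set_scope.
Local Open Scope ring_scope.

Set Implicit Arguments.
Unset Strict Implicit.
Unset Printing Implicit Defensive.

(** * Points close to the integers *)

Definition near_integer (R : realType) (c w : R) : Prop :=
  exists2 m : R, m \is a Num.int & `|w - m| <= c.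

Lemma int_norm_lt1 (R : realType) (m : R) :
  m \is a Num.int -> -1 < m < 1 -> m = 0.
Proof.
move=> mZ /andP[m1 m2]; apply/eqP; case: (eqVneq m 0) => // m0.
by have := norm_intr_ge1 mZ m0; rewrite leNgt ltr_norml m1 m2.
Qed.

(** No point strictly between [m0 + c] and [m0 + 1 - c] is near an integer. A [w] with
    [c <= w - m0 < 1 - c] would have small right shifts in this gap. Approaching from the right is
    what excludes the endpoint [m + c]. *)
Lemma near_integer_rlim (R : realType) (c w : R) :
  (forall e : R, 0 < e -> exists2 d : R, 0 < d < e & near_integer c (w + d)) ->
  exists2 m : R, m \is a Num.int & - c <= w - m < c.
Proof.
move=> H; have /andP[f1] := floor_itv w.
set m0 : R := (Num.floor w)%:~R; rewrite rmorphD /= -/m0 => f2.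
have m0Z : m0 \is a Num.int by apply: intr_int.
have [h1|h1] := ltP (w - m0) c.
  by exists m0 => //; rewrite h1; have [] := lerP (- c) (w - m0) => //; lra.
have [h2|h2] := leP (1 - c) (w - m0).
  exists (m0 + 1); first by rewrite rpredD // rpred1.
  by apply/andP; split; lra.
have [|d /andP[d0 d1] [m mZ]] := H (1 - c - (w - m0)); first by lra.
rewrite ler_norml => /andP[h3 h4].
suff : m - m0 = 0 by move=> ?; lra.
by apply: int_norm_lt1; [rewrite rpredB | apply/andP; split; lra].
Qed.

(** * Nonexistence of the periodic backward orbit *)

Section PeriodicOrbit.
Variables (R : realType) (q l P : nat) (u : nat -> R).
Hypotheses (q3 : (3 <= q)%N) (hl : (1 <= l <= q - 2)%N) (P0 : (0 < P)%N).
Let c : R := q%:R^-1.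
Hypothesis uS : forall j, q%:R * u j.+1 - u j \is a Num.int.
Hypothesis uP : forall j, u (j + P)%N - u j \is a Num.int.
(** The error [d] will be [l] times the scaled tail of the series. Its positivity makes the interval
    in [orbit_rlim] half-open. *)
Hypothesis uK : forall (j : nat) (e : R), 0 < e ->
  exists2 d : R, 0 < d < e & near_integer c (u j + l%:R * c ^+ j + d).

Let qR : 3 <= q%:R :> R. Proof. by rewrite ler_nat. Qed.
Let c0 : 0 < c. Proof. by rewrite invr_gt0 (lt_le_trans _ qR). Qed.
Let qc : q%:R * c = 1. Proof. by rewrite mulfV // lt0r_neq0 // (lt_le_trans _ qR). Qed.
Let c3 : 3 * c <= 1. Proof. by rewrite -[leRHS]qc ler_pM2r. Qed.

Lemma periodic_orbit_iter j i : u (j + i * P)%N - u j \is a Num.int.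
Proof.
elim: i => [|i IH]; first by rewrite mul0n addn0 subrr rpred0.
rewrite mulSn addnCA addnC -(subrKA (u (j + i * P)%N)).
by rewrite rpredD.
Qed.

Lemma orbit_rlim j : exists2 m : R, m \is a Num.int &
  - c <= u j + l%:R * c ^+ j - m < c.
Proof. by apply: near_integer_rlim => e /(uK j). Qed.

(* The perturbation [l c^j] is removed by going back many periods. *)
Lemma orbit_near j : exists2 m : R, m \is a Num.int & - c <= u j - m < c.
Proof.
apply: near_integer_rlim => e e0.
(* Since [c <= 1/2], going back [i] periods brings the perturbation below [e / 2], which leaves
   [e / 2] for [d]. *)
set i := Num.bound (l%:R * 2 / e).
have lt_i : l%:R * c ^+ (j + i * P) < e / 2.
  have h : l%:R * 2 / e < 2 ^+ (j + i * P).
    by apply: upper_nthrootP; rewrite -/i; nia.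
  have h2 : 2 ^+ (j + i * P) * c ^+ (j + i * P) <= 1.
    by rewrite -exprMn exprn_ile1 //; have := c3; have := c0; lra.
  have h3 : 0 < c ^+ (j + i * P) by rewrite exprn_gt0.
  have h4 : l%:R * 2 / e * c ^+ (j + i * P) < 1.
    by apply: lt_le_trans h2; rewrite ltr_pM2r.
  move: h4; rewrite mulrAC ltr_pdivrMr //; lra.
have [|d /andP[d0 d1] [m mZ hm]] := uK (j + i * P) (e := e / 2); first by lra.
exists (l%:R * c ^+ (j + i * P) + d).
  have : 0 <= l%:R * c ^+ (j + i * P) by rewrite mulr_ge0 // exprn_ge0 // ltW.
  by move=> h; apply/andP; split; lra.
exists (m - (u (j + i * P)%N - u j)).
  by rewrite rpredB // periodic_orbit_iter.
by congr (`|_| <= _): hm; ring.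
Qed.

Lemma no_periodic_orbit : False.
Proof.
have /choice[v hv] : forall j, exists v : R, v - u j \is a Num.int /\ - c <= v < c.
  move=> j; have [m mZ hm] := orbit_near j; exists (u j - m); split=> //.
  by rewrite addrAC subrr sub0r rpredN.
have v1 j : - c <= v j by have [_ /andP[]] := hv j.
have v2 j : v j < c by have [_ /andP[]] := hv j.
have vu j : v j - u j \is a Num.int by have [] := hv j.
have vS j : q%:R * v j.+1 - v j \is a Num.int.
  have -> : q%:R * v j.+1 - v j = q%:R * (v j.+1 - u j.+1) - (v j - u j)
    + (q%:R * u j.+1 - u j) by ring.
  by rewrite rpredD // rpredB // rpredM // rpred_nat.
(* The window [[-c, c)] is shorter than 1, so congruence modulo 1 becomes equality. *)
have vP j : v (j + P)%N = v j.
  apply/eqP; rewrite -subr_eq0; apply/eqP; apply: int_norm_lt1.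
    have -> : v (j + P)%N - v j = (v (j + P)%N - u (j + P)%N) - (v j - u j)
      + (u (j + P)%N - u j) by ring.
    by rewrite rpredD // rpredB.
  have := v1 j; have := v1 (j + P)%N; have := v2 j; have := v2 (j + P)%N.
  by move=> *; have := c3; lra.
have vK j : exists2 m : R, m \is a Num.int & - c <= v j + l%:R * c ^+ j - m < c.
  have [m mZ hm] := orbit_rlim j; exists (m + (v j - u j)); first by rewrite rpredD.
  by have -> : v j + l%:R * c ^+ j - (m + (v j - u j)) = u j + l%:R * c ^+ j - m
    by ring.
have [l1 l2] : 1 <= l%:R :> R /\ l%:R + 2 <= q%:R :> R.
  by rewrite (ler_nat _ 1) -natrD ler_nat; split; lia.
have lc1 : c <= l%:R * c by rewrite ler_peMl // ltW.
have lc2 : l%:R * c + 2 * c <= 1 by rewrite -mulrDl -[leRHS]qc ler_pM2r.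
(* As [l <= q - 2], [v 1 + l c] stays below [1 - c], so the only integer it can be close to is 0.
   With [v 1 >= -c] this leaves [l < 2]. *)
have small_l : l%:R * c < c - v 1%N.
  have [m mZ] := vK 1%N; rewrite expr1 => /andP[m1 m2].
  suff m0 : m = 0 by rewrite m0 in m1 m2; lra.
  by apply: int_norm_lt1 => //; have := v1 1%N; have := v2 1%N; have := c3; lra.
have l_eq1 : l = 1%N.
  have : l%:R * c < 2 * c by have := v1 1%N; lra.
  by rewrite ltr_pM2r // ltr_nat; lia.
rewrite {}l_eq1 mul1r in vK small_l.
have v1_lt0 : v 1%N < 0 by lra.
(* The perturbation [c^j] carries leftwards through the digits [q - 1] of [u].
   The first digit [0] met (the case [m = 1]) would become the forbidden digit
   [1], so all digits are [q - 1] and [v] decays geometrically, against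
   periodicity. *)
have vE j : v j.+1 = v 1%N * c ^+ j.
  elim: j => [|j IH]; first by rewrite mulr1.
  have cj : 0 < c ^+ j by rewrite exprn_gt0.
  have cj1 : c ^+ j <= 1.
    by rewrite exprn_ile1 //; have := c3; have := c0; lra.
  have vlt0 : v j.+1 < 0 by rewrite IH nmulr_rlt0.
  set m := q%:R * v j.+2 - v j.+1.
  have mZ : m \is a Num.int := vS j.+1.
  have vm : v j.+2 = c * (m + v j.+1) by rewrite /m subrK mulrA (mulrC c) qc mul1r.
  suff m0 : m = 0 by rewrite vm m0 add0r IH exprS; ring.
  (* The window for [v] and the sign of [v j.+1] leave only the digits 0 and 1. *)
  have m1 : -1 < m.
    have : c * (- 1) <= c * (m + v j.+1) by rewrite -vm mulrN1.
    by rewrite ler_pM2l //; lra.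
  have m2 : m < 2.
    have : c * (m + v j.+1) < c * 1 by rewrite -vm mulr1.
    by rewrite ltr_pM2l //; have := v1 j.+1; have := c3; lra.
  have [mlt1|m1'] := ltP m 1; first by apply: int_norm_lt1 => //; rewrite m1.
  exfalso; have {m1' m2} m_eq1 : m = 1.
    apply/eqP; rewrite -subr_eq0; apply/eqP; apply: int_norm_lt1.
      by rewrite rpredB // rpred1.
    by apply/andP; split; lra.
  (* With [m = 1] the sum equals [c + c^(j+1) (v 1 + c)]. It thus falls in [[c, 1 - c)], a gap that
     [vK] forbids. *)
  have ge_c : c <= v j.+2 + c ^+ j.+2.
    rewrite vm m_eq1 IH !exprS.
    have -> : c * (1 + v 1%N * c ^+ j) + c * (c * c ^+ j)
      = c + c * ((v 1%N + c) * c ^+ j) by ring.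
    rewrite lerDl pmulr_rge0 // pmulr_lge0 //; have := v1 1%N; lra.
  have lt_c : v j.+2 + c ^+ j.+2 < 1 - c.
    have : c ^+ j.+2 <= c.
      by rewrite exprS ler_piMr ?(ltW c0) // exprn_ile1 //; have := c3; have := c0; lra.
    by have := v2 j.+2; have := c3; lra.
  have [m' m'Z] := vK j.+2; rewrite mul1r => /andP[m'1 m'2].
  suff m'0 : m' = 0 by lra.
  by apply: int_norm_lt1 => //; have := c0; lra.
have /eqP := vP 1%N; rewrite add1n vE -subr_eq0 -[X in _ - X]mulr1 -mulrBr.
rewrite mulf_eq0 lt_eqF //= subr_eq0 lt_eqF // exprn_ilt1 ?(ltW c0) //.
- by rewrite -lt0n.
- by have := c3; have := c0; lra.
Qed.

End PeriodicOrbit.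

(** * Eventual periodicity of rational orbits *)

Lemma expn_modn_periodic (q b : nat) : (0 < b)%N ->
  exists2 P, (0 < P)%N &
    forall k, (P <= k)%N -> (q ^ (k + P) = q ^ k %[mod b])%N.
Proof.
move=> b0.
have [i [p p0 hi]] : exists i, exists2 p, (0 < p)%N & (q ^ (i + p) = q ^ i %[mod b])%N.
  (* Pigeonhole: [b + 1] powers share [b] residues. *)
  pose f (i : 'I_b.+1) : 'I_b := Ordinal (ltn_pmod (q ^ i)%N b0).
  have /injectivePn[i [j ij /(congr1 val) /= fij]] : ~~ injectiveb f.
    by apply/negP => /injectiveP /leq_card; rewrite !card_ord ltnn.
  wlog lt_ij : i j ij fij / (i < j)%N.
    move=> W; case: (ltngtP i j) => [|lt_ji|/val_inj/eqP]; first exact: W.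
      by apply: (W j i) => //; rewrite eq_sym.
    by rewrite (negbTE ij).
  by exists i, (j - i)%N; rewrite ?subn_gt0 ?subnKC // ltnW.
have per k : (i <= k)%N -> (q ^ (k + p) = q ^ k %[mod b])%N.
  move=> /subnKC <-; rewrite addnAC expnD -modnMml hi modnMml -expnD; exact: erefl.
have perM t k : (i <= k)%N -> (q ^ (k + t * p) = q ^ k %[mod b])%N.
  move=> ik; elim: t => [|t IH]; first by rewrite mul0n addn0.
  by rewrite mulSn addnCA addnC per // (leq_trans ik) ?leq_addr.
(* A multiple of [p] that is at least [i] serves both as period and as bound on the preperiod. *)
exists (i.+1 * p)%N => [|k hk]; first by rewrite muln_gt0.
by apply: perM; apply: leq_trans hk; nia.
Qed.

(** The denominator of [r] divides [q^(k + P) - q^k]. *)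
Lemma rat_orbit_periodic (R : realType) (q : nat) (r : rat) :
  exists2 P, (0 < P)%N & forall k, (P <= k)%N ->
    q%:R ^+ (k + P) * ratr r - q%:R ^+ k * ratr r \is a @Num.int R.
Proof.
have b0 : (0 < `|denq r|)%N by rewrite absz_gt0 denq_neq0.
have [P P0 hP] := expn_modn_periodic q b0.
exists P => // k /hP.
set x := (q ^ (k + P))%N; set y := (q ^ k)%N => xy.
rewrite -!natrX -/x -/y -mulrBl.
have [t ht] : exists t : int, x%:Z - y%:Z = t * denq r.
  have /dvdzP : (denq r %| x%:Z - y%:Z)%Z.
    rewrite -eqz_mod_dvd -[denq r]gez0_abs ?denq_ge0 //.
    by rewrite !modz_nat; apply/eqP; congr Posz.
  by [].
have -> : x%:R - y%:R = (t * denq r)%:~R :> R by rewrite -ht intrB.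
have dn0 : (denq r)%:~R != 0 :> R by rewrite intr_eq0 denq_neq0.
by rewrite /ratr intrM -mulrA [X in _ * X]mulrCA mulfV // mulr1 -intrM intr_int.
Qed.

(** * Tail and shifts of the factorial series *)

Section FactorialSeries.
Variables (R : realType) (q : nat).
Hypothesis q2 : (2 <= q)%N.
Let c : R := q%:R^-1.
Let S (N : nat) : R := \sum_(1 <= n < N.+1) 1 / q%:R ^+ n`!.

Let SS N : S N.+1 = S N + c ^+ N.+1`!.
Proof. by rewrite /S big_nat_recr //= div1r exprVn. Qed.

Let c0 : 0 < c. Proof. by rewrite invr_gt0 ltr0n; lia. Qed.
Let c2 : 2 * c <= 1.
Proof. by rewrite ler_pdivrMr ?mul1r ?ler_nat // ltr0n; lia. Qed.

Lemma factorial_series_itv n :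
  S n < factorial_series R q <= S n + 2 * c ^+ n.+1`!.
Proof.
have Sle : {homo S : n m / (n <= m)%N >-> n <= m}.
  apply: homo_leq => [//|? ? ?|N]; first exact: le_trans.
  by rewrite SS lerDl exprn_ge0 // ltW.
(* The upper bounds decrease with [N], so each of them dominates all later partial sums. *)
have Sdec N : S N.+1 + 2 * c ^+ N.+2`! <= S N + 2 * c ^+ N.+1`!.
  rewrite SS -addrA lerD2l.
  have : c ^+ N.+2`! <= c * c ^+ N.+1`!.
    rewrite -exprS ler_wiXn2l ?(ltW c0) //; first by have := c2; have := c0; lra.
    by rewrite [N.+2`!]factS; have := fact_gt0 N.+1; nia.
  have h : 0 < c ^+ N.+1`! by rewrite exprn_gt0.
  have : 2 * c * c ^+ N.+1`! <= 1 * c ^+ N.+1`! by rewrite ler_pM2r.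
  by lra.
have Sub m : (n <= m)%N -> S m <= S n + 2 * c ^+ n.+1`!.
  move=> nm; apply: (@le_trans _ _ (S m + 2 * c ^+ m.+1`!)).
    by rewrite lerDl mulr_ge0 // exprn_ge0 // ltW.
  elim: m nm => [|m IH]; first by rewrite leqn0 => /eqP ->.
  rewrite leq_eqVlt => /predU1P[->//|/IH]; exact/le_trans/Sdec.
have cS : cvgn S.
  apply: nondecreasing_is_cvgn => //.
  exists (S n + 2 * c ^+ n.+1`!) => _ [m _ <-].
  by have [/Sub//|/ltnW/Sle/le_trans] := leqP n m; apply; apply: Sub.
apply/andP; split.
  apply: (@lt_le_trans _ _ (S n.+1)); first by rewrite SS ltrDl exprn_gt0.
  exact: nondecreasing_cvgn_le.
by apply: limr_le => //; exists n.
Qed.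

(** The factor [q^(n! - j)] makes the terms before the [n]-th integers and turns the [n]-th into
    [c^j]. The remaining tail is [d], at most [2 c^(n n!)]. *)
Lemma factorial_series_shift (j : nat) (e : R) (n0 : nat) : 0 < e ->
  exists2 n, (n0 <= n)%N & exists2 d, 0 < d < e &
    q%:R ^+ (n`! - j) * factorial_series R q - c ^+ j - d \is a Num.int.
Proof.
(* Here [n = m + 1]. From [j <= m] follows [m! <= n! - j], which clears the earlier denominators;
   the last bound gives [2 c^m < e]. *)
move=> e0; set m := (maxn n0 (maxn j (Num.bound (2 / e)))).
have [hm1 hm2 hm3] : [/\ n0 <= m, j <= m & Num.bound (2 / e) <= m]%N.
  by rewrite /m; split; lia.
have m0 : (0 < m`!)%N := fact_gt0 m.
have hj : (m`! <= m.+1`! - j)%N by rewrite factS; nia.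
have hj' : (j <= m.+1`!)%N by rewrite factS; nia.
exists m.+1; first exact: leqW.
have /andP[h1 h2] := factorial_series_itv m.+1.
have q0 k : 0 < q%:R ^+ k :> R by rewrite exprn_gt0 // ltr0n; lia.
have qc k k' : (k' <= k)%N -> q%:R ^+ k * c ^+ k' = q%:R ^+ (k - k') :> R.
  move=> kk; rewrite -{1}(subnK kk) exprD -mulrA -exprMn.
  by rewrite mulfV ?expr1n ?mulr1 // pnatr_eq0; lia.
exists (q%:R ^+ (m.+1`! - j) * (factorial_series R q - S m.+1)).
  rewrite mulr_gt0 ?subr_gt0 //=.
  have le1 : q%:R ^+ (m.+1`! - j) * (factorial_series R q - S m.+1)
      <= q%:R ^+ m.+1`! * (2 * c ^+ m.+2`!).
    rewrite ler_pM ?(ltW (q0 _)) ?subr_ge0 ?(ltW h1) ?lerBlDl //.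
    by rewrite ler_weXn2l ?leq_subr // (ler_nat _ 1); lia.
  apply: le_lt_trans le1 _; rewrite mulrCA.
  have -> : q%:R ^+ m.+1`! * c ^+ m.+2`! = c ^+ (m.+1 * m.+1`!).
    rewrite [m.+2`!]factS mulSn exprD mulrA qc // subnn expr0 mul1r; exact: erefl.
  have le2 : c ^+ (m.+1 * m.+1`!) <= c ^+ m.
    rewrite ler_wiXn2l ?(ltW c0) //; first by have := c2; have := c0; lra.
    by have := fact_gt0 m.+1; nia.
  have h : 2 / e < 2 ^+ m by apply: upper_nthrootP.
  have h' : 2 ^+ m * c ^+ m <= 1.
    by rewrite -exprMn exprn_ile1 //; have := c2; have := c0; lra.
  have cm : 0 < c ^+ m by rewrite exprn_gt0.
  have : 2 / e * c ^+ m < 1 by apply: lt_le_trans h'; rewrite ltr_pM2r.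
  by rewrite mulrAC ltr_pdivrMr //; lra.
rewrite SS mulrBr mulrDr.
have -> : q%:R ^+ (m.+1`! - j) * c ^+ m.+1`! = c ^+ j.
  rewrite -{2}(subnK hj') exprD mulrA qc // subnn expr0 mul1r; exact: erefl.
set a := _ * S m; set b := _ * factorial_series R q.
have -> : b - c ^+ j - (b - (a + c ^+ j)) = a by ring.
rewrite /a mulr_sumr big_nat_cond rpred_sum // => i /andP[/andP[_ im] _].
by rewrite div1r -exprVn qc ?rpredX ?rpred_nat // (leq_trans _ hj) // leq_fact.
Qed.

End FactorialSeries.

(** * Orbits in the self-similar set *)

Section SelfSimilar.
Variables (R : realType) (q : nat) (K : set R).
Hypotheses (q2 : (2 <= q)%N) (ssK : self_similar_set (ifs1 q) (ifs2 q) K).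

Let KE : K = (ifs1 q @` K) `|` (ifs2 q @` K). Proof. by case: ssK. Qed.
Let q0 : 0 < q%:R :> R. Proof. by rewrite ltr0n; lia. Qed.
Let qn0 : q%:R != 0 :> R. Proof. by rewrite lt0r_neq0. Qed.

Lemma self_similar_ifs_inv x : K x ->
  exists2 y, K y & x = ifs1 q y \/ x = ifs2 q y.
Proof. by rewrite {1}KE => -[] [y Ky <-]; exists y; auto. Qed.

Lemma self_similar_ifs1 x : K x -> K (ifs1 q x).
Proof. by move=> Kx; rewrite KE; left; exists x. Qed.

Lemma self_similar_ifs2 x : K x -> K (ifs2 q x).
Proof. by move=> Kx; rewrite KE; right; exists x. Qed.

(** Both maps send [[0, 1]] into itself and contract by at least 2, so any excess [B] beyond
    [[0, 1]] can be halved indefinitely. *)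
Lemma self_similar_unit_itv x : K x -> 0 <= x <= 1.
Proof.
have [B B0 hB] : exists2 B : R, 0 <= B & forall x, K x -> - B <= x <= 1 + B.
  have [M [Mr hM]] : bounded_set K by apply: compact_bounded; case: ssK.
  exists (`|M| + 1) => [|y Ky]; first by rewrite addr_ge0.
  have : `|y| <= `|M| + 1.
    by apply: (hM _ _ y Ky); rewrite (le_lt_trans (ler_norm M)) // ltrDl.
  by rewrite ler_norml => /andP[]; lra.
have hn n : forall x, K x -> - (B / 2 ^+ n) <= x <= 1 + B / 2 ^+ n.
  elim: n => [|n IH] y Ky; first by rewrite divr1; exact: hB.
  have /andP[] : 0 <= B / 2 ^+ n.+1 <= B / 2 ^+ n / 2.
    by rewrite exprS invfM mulrA mulrAC lexx andbT !divr_ge0 // exprn_ge0.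
  have [z /IH /andP[]] := self_similar_ifs_inv Ky.
  set b := B / 2 ^+ n; set b' := B / _ => z1 z2 zE b'0 b'b.
  have qb : q%:R * b' >= b.
    apply: (@le_trans _ _ (2 * b')); last by rewrite ler_wpM2r // ler_nat.
    by rewrite /b /b' exprS invfM; lra.
  have qR : 2 <= q%:R :> R by rewrite ler_nat.
  case: zE => ->; rewrite /ifs1 /ifs2 ler_pdivlMr // ler_pdivrMr //.
    by apply/andP; split; lra.
  by apply/andP; split; lra.
have Bn e : 0 < e -> exists n, B / 2 ^+ n < e.
  move=> e0; exists (Num.bound (B / e)).
  rewrite ltr_pdivrMr ?exprn_gt0 // mulrC -ltr_pdivrMr //.
  exact: upper_nthrootP.
move=> Kx; apply/andP; split; apply/ler_addgt0Pr => e /Bn[n hne];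
  by have /andP[] := hn n _ Kx; lra.
Qed.

(** Modulo 1, multiplication by [q] inverts both maps, as their translations differ by the integer
    [q - 1] after scaling. *)
Lemma self_similar_orbit k x : K x ->
  exists2 y, K y & q%:R ^+ k * x - y \is a Num.int.
Proof.
elim: k x => [|k IH] x Kx.
  by exists x; rewrite // mul1r subrr rpred0.
have [y Ky yE] := self_similar_ifs_inv Kx.
have [z Kz zy] := IH _ Ky; exists z => //.
rewrite exprSr -mulrA.
case: yE => ->; rewrite /ifs1 /ifs2 (mulrC q%:R) divfK //.
have -> : q%:R ^+ k * (y + q%:R - 1) - z
  = (q%:R ^+ k * y - z) + q%:R ^+ k * (q%:R - 1) by ring.
by rewrite rpredD // rpredM ?rpredX ?rpredB ?rpred_nat ?rpred1.
Qed.

(** The two images of [[0, 1]] are [[0, 1/q]], next to 0, and [[1 - 1/q, 1]], next to 1. *)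
Lemma self_similar_near_integer k x : K x ->
  near_integer q%:R^-1 (q%:R ^+ k * x).
Proof.
move=> /(self_similar_orbit k)[y Ky yZ].
have [z /self_similar_unit_itv/andP[z0 z1] zE] := self_similar_ifs_inv Ky.
suff [m mZ hm] : near_integer q%:R^-1 y.
  exists (q%:R ^+ k * x - y + m); first by rewrite rpredD.
  by have -> : q%:R ^+ k * x - (q%:R ^+ k * x - y + m) = y - m by ring.
case: zE => ->; rewrite /ifs1 /ifs2.
  exists 0; first exact: rpred0.
  by rewrite subr0 ger0_norm ?divr_ge0 ?ler0n // ler_piMl // invr_ge0 ler0n.
exists 1; first exact: rpred1.
have -> : (z + q%:R - 1) / q%:R - 1 = - ((1 - z) / q%:R) by field.
rewrite normrN ger0_norm ?divr_ge0 ?subr_ge0 ?ler0n //.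
by rewrite ler_piMl ?invr_ge0 ?ler0n //; lra.
Qed.

End SelfSimilar.

(** * Irrationality of the translated set *)

Lemma self_similar_sub_series_irrational (R : realType) (q : nat) (K : set R) (l : nat) :
  (3 <= q)%N -> self_similar_set (ifs1 q) (ifs2 q) K -> (1 <= l <= q - 2)%N ->
  [set x - l%:R * factorial_series R q | x in K] `<=` @irrational R.
Proof.
move=> q3 ssK hl _ [x Kx <-] [r _ rE].
have q2 : (2 <= q)%N by lia.
have [P P0 hP] := rat_orbit_periodic R q r.
have hPi k i : (P <= k)%N ->
    q%:R ^+ (k + i * P) * ratr r - q%:R ^+ k * ratr r \is a @Num.int R.
  move=> hk; elim: i => [|i IH]; first by rewrite mul0n addn0 subrr rpred0.
  rewrite mulSn addnCA addnC -(subrKA (q%:R ^+ (k + i * P) * ratr r)).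
  by rewrite rpredD // hP // (leq_trans hk) ?leq_addr.
(* [E j] is congruent to [- j] modulo [P], as is [n`! - j] for [n >= P]. *)
pose E j := (P + P.-1 * j)%N.
pose u j : R := q%:R ^+ E j * ratr r.
apply: (@no_periodic_orbit R q l P u) => // j.
- have -> : q%:R * u j.+1 = q%:R ^+ (E j + 1 * P) * ratr r.
    rewrite /u mulrA -exprS; congr (_ ^+ _ * _); rewrite /E; nia.
  by apply: hPi; rewrite leq_addr.
- have -> : u (j + P)%N = q%:R ^+ (E j + P.-1 * P) * ratr r.
    by rewrite /u; congr (_ ^+ _ * _); rewrite /E; nia.
  by apply: hPi; rewrite leq_addr.
move=> e e0.
have l0 : 0 < l%:R :> R by rewrite ltr0n; lia.
(* The tolerance is divided by [l] because the series is multiplied by [l]. The bound [P * j.+2]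
   ensures that [P] divides [n!] with quotient at least [j + 1]. *)
have [|n hn [d /andP[d0 d1] dZ]] :=
  @factorial_series_shift R q q2 j (e / l%:R) (P * j.+2); first by rewrite divr_gt0.
exists (l%:R * d); first by rewrite mulr_gt0 //= mulrC -ltr_pdivlMr.
have [m mZ hm] := self_similar_near_integer q2 ssK (n`! - j) Kx.
have rZ : q%:R ^+ (n`! - j) * ratr r - u j \is a @Num.int R.
  have /dvdnP[t tE] : (P %| n`!)%N by rewrite dvdn_fact // P0; nia.
  have nfact : (n <= n`!)%N by rewrite dvdn_leq ?fact_gt0 // dvdn_fact // leqnn andbT; nia.
  have tj : (j.+1 <= t)%N by nia.
  have -> : (n`! - j = E j + (t - j.+1) * P)%N.
    by rewrite tE /E mulnBl; nia.
  by apply: hPi; rewrite leq_addr.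
set s := factorial_series R q in rE dZ *.
(* Since [x = r + l s], the integer [m] near [q^(n! - j) x] is corrected by the integer parts
   dropped from the [r] and [s] terms. *)
exists (m - (q%:R ^+ (n`! - j) * ratr r - u j)
  - l%:R * (q%:R ^+ (n`! - j) * s - q%:R^-1 ^+ j - d)).
  by apply: rpredB; [exact: rpredB | rewrite rpredM // rpred_nat].
congr (`|_| <= _): hm.
by rewrite -[x](subrK (l%:R * s)) -rE; ring.
Qed.

(** * The middle-third Cantor set as the case [q = 3] *)

Section Cantor.
Variable R : realType.
Local Notation f1 := (@ifs1 R 3).
Local Notation f2 := (@ifs2 R 3).
Local Notation C := (middle_third_cantor_set R).

Let map_itv (f : R -> R) (I : R * R) : R * R := (f I.1, f I.2).

Let affine_remove (f : R -> R) (a b : R) (I : R * R) :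
  (forall x, f x = a * x + b) ->
  remove_middle_third (map_itv f I) = map (map_itv f) (remove_middle_third I).
Proof.
by case: I => x y fE; rewrite /= /map_itv /= !fE; congr [:: (_, _); (_, _)]; field.
Qed.

Let f1E x : f1 x = 3^-1 * x + 0.
Proof. by rewrite /ifs1; field. Qed.

Let f2E x : f2 x = 3^-1 * x + 2 / 3.
Proof. by rewrite /ifs2; field. Qed.

(* The intervals are defined by splitting the innermost ones; self-similarity
   comes from splitting outermost first. *)
Lemma cantor_intervalsS n : cantor_intervals R n.+1 =
  map (map_itv f1) (cantor_intervals R n) ++ map (map_itv f2) (cantor_intervals R n).
Proof.
have step (f : R -> R) a b (s : seq (R * R)) : (forall x, f x = a * x + b) ->
    flatten (map (@remove_middle_third R) (map (map_itv f) s))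
    = map (map_itv f) (flatten (map (@remove_middle_third R) s)).
  move=> fE; rewrite map_flatten -!map_comp; congr flatten.
  by apply: eq_map => I; exact: affine_remove fE.
elim: n => [|n IH].
  by rewrite /= /map_itv /= !f1E !f2E; congr [:: (_, _); (_, _)]; field.
rewrite [LHS]/= -/(cantor_intervals R n.+1) [in LHS]IH map_cat flatten_cat.
by rewrite (step _ _ _ _ f1E) (step _ _ _ _ f2E).
Qed.

(** With [cantor_stage0], this recursion replaces the interval lists in all that follows. *)
Lemma cantor_stageS n x : cantor_stage R n.+1 x <->
  cantor_stage R n (3 * x) \/ cantor_stage R n (3 * x - 2).
Proof.
split=> [[I]|].
  rewrite cantor_intervalsS mem_cat => /orP[] /mapP[J Jn ->] /=;
    rewrite ?f1E ?f2E => /andP[h1 h2]; [left|right]; exists J => //;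
    by apply/andP; split; lra.
move=> [] [J Jn /andP[h1 h2]]; [exists (map_itv f1 J)|exists (map_itv f2 J)];
  rewrite ?cantor_intervalsS ?mem_cat ?map_f ?orbT //= ?f1E ?f2E;
  by apply/andP; split; lra.
Qed.

Lemma cantor_stage0 x : cantor_stage R 0 x <-> 0 <= x <= 1.
Proof.
split=> [[I]|h]; first by rewrite inE => /eqP ->.
by exists (0, 1) => //; rewrite inE.
Qed.

Lemma cantor_stage_unit_itv n x : cantor_stage R n x -> 0 <= x <= 1.
Proof.
elim: n x => [|n IH] x; first by move/cantor_stage0.
by move=> /cantor_stageS[] /IH /andP[? ?]; apply/andP; split; lra.
Qed.

Lemma closed_cantor_stage n : closed (cantor_stage R n).
Proof.
elim: n => [|n IH].
  have -> : cantor_stage R 0 = `[0, 1]%classic.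
    by apply/seteqP; split=> x; rewrite /= in_itv /= => /cantor_stage0.
  exact: itv_closed.
have -> : cantor_stage R n.+1 = (fun x : R => 3 * x) @^-1` cantor_stage R n `|`
    (fun x : R => 3 * x - 2) @^-1` cantor_stage R n.
  by apply/seteqP; split=> x /cantor_stageS.
apply: closedU; apply: preimage_closed => // x _.
  by apply: cvgM; [exact: cvg_cst | exact: cvg_id].
by apply: cvgB; [apply: cvgM; [exact: cvg_cst | exact: cvg_id] | exact: cvg_cst].
Qed.

Lemma cantor_self_similar : self_similar_set f1 f2 C.
Proof.
split.
- exists 0 => n _; elim: n => [|n IH]; first by apply/cantor_stage0; lra.
  by apply/cantor_stageS; left; rewrite mulr0.
- apply: (subclosed_compact _ (@segment_compact R 0 1)).
    by apply: closed_bigI => n _; exact: closed_cantor_stage.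
  by move=> x /(_ 0%N I) /cantor_stage0; rewrite /= in_itv.
apply/seteqP; split=> x.
  move=> Cx; have Cx' n := Cx n I.
  (* The side of 1/2 decides the branch uniformly in [n]: the other preimage lies outside [[0, 1]],
     hence outside every stage. *)
  have [x12|x12] := leP x 2^-1.
    left; exists (3 * x); last by rewrite f1E; field.
    move=> n _; have /cantor_stageS[//|/cantor_stage_unit_itv/andP[]] := Cx' n.+1.
    by lra.
  right; exists (3 * x - 2); last by rewrite f2E; field.
  move=> n _; have /cantor_stageS[/cantor_stage_unit_itv/andP[]|//] := Cx' n.+1.
  by lra.
move=> [] [y Cy <-] [|n] _.
- have /cantor_stage0/andP[] := Cy 0%N I.
  by move=> *; apply/cantor_stage0; rewrite f1E; apply/andP; split; lra.
- apply/cantor_stageS; left; rewrite f1E.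
  have -> : 3 * (3^-1 * y + 0) = y by field.
  exact: Cy.
- have /cantor_stage0/andP[] := Cy 0%N I.
  by move=> *; apply/cantor_stage0; rewrite f2E; apply/andP; split; lra.
- apply/cantor_stageS; right; rewrite f2E.
  have -> : 3 * (3^-1 * y + 2 / 3) - 2 = y by field.
  exact: Cy.
Qed.

(** Unfolding the equation of [K] [n] times puts [K] inside stage [n]. Conversely, following the
    branches of a point of [C] from any [y0] in [K] gives points of [K] converging to it, and [K] is
    closed. *)
Lemma self_similar_cantor (K : set R) : self_similar_set f1 f2 K -> K = C.
Proof.
move=> ssK; have [[y0 Ky0] cK _] := ssK.
apply/seteqP; split=> x.
  move=> Kx n _; elim: n x Kx => [|n IH] x Kx.
    by apply/cantor_stage0; exact: (self_similar_unit_itv _ ssK).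
  apply/cantor_stageS; have [y Ky []] := self_similar_ifs_inv ssK Kx.
    rewrite f1E => ->; left.
    have -> : 3 * (3^-1 * y + 0) = y by field.
    exact: IH.
  rewrite f2E => ->; right.
  have -> : 3 * (3^-1 * y + 2 / 3) - 2 = y by field.
  exact: IH.
move=> Cx; apply: (compact_closed (@Rhausdorff R) cK).
(* The rate [2^-n], weaker than the true [3^-n], suits the comparison with [Num.bound]. *)
have approx n : forall z, cantor_stage R n z -> exists2 y, K y & `|z - y| <= 2^-1 ^+ n.
  elim: n => [|n IH] z.
    move=> /cantor_stage0/andP[z0 z1]; exists y0 => //.
    have /andP[] := self_similar_unit_itv (isT : (2 <= 3)%N) ssK Ky0.
    by rewrite expr0 ler_norml => *; apply/andP; split; lra.
  have h0 : 0 <= 2^-1 ^+ n :> R by rewrite exprn_ge0 // invr_ge0.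
  rewrite exprS => /cantor_stageS[] /IH [y Ky]; rewrite ler_norml => /andP[y1 y2].
    exists (f1 y); first exact: (self_similar_ifs1 ssK).
    by rewrite f1E ler_norml; apply/andP; split; lra.
  exists (f2 y); first exact: (self_similar_ifs2 ssK).
  by rewrite f2E ler_norml; apply/andP; split; lra.
move=> B /nbhs_ballP[e /= e0 eB].
have [y Ky xy] := approx (Num.bound e^-1) x (Cx _ I).
exists y; split=> //; apply: eB; apply: le_lt_trans xy _.
rewrite exprVn invf_plt ?posrE ?exprn_gt0 //; exact: upper_nthrootP.
Qed.

End Cantor.

Theorem theorem1p4 (R : realType) :
  [/\ forall (q : nat) (K : set R), (3 <= q)%N ->
        self_similar_set (ifs1 q) (ifs2 q) K ->
        forall l : nat, (1 <= l <= q - 2)%N ->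
          [set x - l%:R * factorial_series R q | x in K] `<=` @irrational R,
      forall K : set R,
        self_similar_set (ifs1 3) (ifs2 3) K <-> K = middle_third_cantor_set R
    & [set x - factorial_series R 3 | x in middle_third_cantor_set R]
        `<=` @irrational R].
Proof.
split.
- by move=> q K q3 ssK l hl; exact: self_similar_sub_series_irrational.
- move=> K; split=> [|->]; first exact: self_similar_cantor.
  exact: cantor_self_similar.
- rewrite -[factorial_series R 3]mul1r.
  exact: (self_similar_sub_series_irrational (l := 1) _ (cantor_self_similar R)).
Qed.
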